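(* Let $K,P\ge 1$ be integers and let the times taken by each of $P$ workers to compute the gradient on one mini-batch be i.i.d. (across workers and mini-batches) with a new-longer-than-used distribution; let $X_1,\dots,X_P$ denote i.i.d. copies. Then the expected runtime per iteration of $K$-batch-sync SGD satisfies $$\mathbb{E}[T]\le K\,\mathbb{E}[X_{1:P}],$$ where $X_{1:P}=\min(X_1,\dots,X_P)$.
   Context: A (nonnegative) random variable $U$ has a new-longer-than-used distribution if $\Pr(U>u+t\mid U>t)\le \Pr(U>u)$ for all $t,u\ge 0$ (whenever the conditional probability is defined). A central parameter server (PS) interacts with $P$ parallel workers; everything other than gradient computation takes zero time. $K$-batch-sync SGD: at each iteration all $P$ workers start computing the gradient on a fresh mini-batch simultaneously; whenever a worker finishes a mini-batch it pushes the gradient and immediately starts computing on another mini-batch (at the same parameter value); the PS updates the parameter when $K$ mini-batches in total have been finished, irrespective of which workers finished them, cancels all ongoing computations, and all $P$ workers start afresh. $T$ is the time between two consecutive updates. *)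

(* Defs.v *)
From HB Require Import structures.
From mathcomp Require Import all_boot all_order all_algebra.
From mathcomp Require Import all_classical all_reals all_analysis.
Set Implicit Arguments.
Unset Strict Implicit.
Unset Printing Implicit Defensive.
Import Order.TTheory GRing.Theory Num.Theory.
Local Open Scope classical_set_scope.
Local Open Scope ring_scope.
Local Open Scope ereal_scope.

(* Pr(A | B); only meaningful when 0 < Pr(B). *)
Definition cond_prob (d : measure_display) (Omega : measurableType d)
    (R : realType) (Pr : probability Omega R) (A B : set Omega) : \bar R :=
  Pr (A `&` B) / Pr B.

(* Almost sure nonnegativity, so that this is a property of the law of U. *)
Definition new_longer_than_used (d : measure_display)
    (Omega : measurableType d) (R : realType) (Pr : probability Omega R)
    (U : {RV Pr >-> R}) : Prop :=
  {ae Pr, forall w, (0 <= U w)%R} /\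
  forall t u : R, (0 <= t)%R -> (0 <= u)%R ->
    0 < Pr [set w | (t < U w)%R] ->
    cond_prob Pr [set w | (u + t < U w)%R] [set w | (t < U w)%R]
      <= Pr [set w | (u < U w)%R].

(* The two variables may live on different probability spaces. *)
Definition identically_distributed (R : realType)
    (d : measure_display) (Omega : measurableType d)
    (Pr : probability Omega R) (U : {RV Pr >-> R})
    (d' : measure_display) (Omega' : measurableType d')
    (Pr' : probability Omega' R) (V : {RV Pr' >-> R}) : Prop :=
  forall B : set R, measurable B ->
    distribution Pr U B = distribution Pr' V B.

(* Mutual independence: the product rule over every finite subfamily, the
   subfamily being given by a duplicate-free list of indices. *)
Definition mutually_independent (d : measure_display)
    (Omega : measurableType d) (R : realType) (Pr : probability Omega R)
    (I : eqType) (X : I -> {RV Pr >-> R}) : Prop :=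
  forall (s : seq I) (B : I -> set R), uniq s ->
    (forall i, measurable (B i)) ->
    Pr [set w | forall i, i \in s -> B i (X i w)]
      = \prod_(i <- s) Pr [set w | B i (X i w)].

Definition iid (d : measure_display) (Omega : measurableType d)
    (R : realType) (Pr : probability Omega R)
    (I : eqType) (X : I -> {RV Pr >-> R}) : Prop :=
  mutually_independent X /\
  forall i j, identically_distributed (X i) (X j).

Section Iteration.
Context (R : realType) (P : nat).

(* [x i j] is the time worker [i] takes on its mini-batch number [j] (counted
   from 0) of the iteration, which starts at time 0. *)
Variable x : 'I_P -> nat -> R.

(* Each worker computes its mini-batches back to back. *)
Definition completion_time (i : 'I_P) (j : nat) : R :=
  (\sum_(l < j.+1) x i l)%R.

(* Simultaneous completions are counted separately; the value may be +oo. *)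
Definition num_finished (t : R) : \bar R :=
  counting [set ij : 'I_P * nat | (completion_time ij.1 ij.2 <= t)%R].

(* Time of the update: first time at which K mini-batches in total have been
   finished. *)
Definition iteration_runtime (K : nat) : R :=
  inf [set t : R | (0 <= t)%R /\ K%:R%:E <= num_finished t].

End Iteration.

(* Main.v *)
(* Call configuration a vector [n : 'I_P -> nat] recording how many mini-batches
   each worker has finished.  The runtime is at most the total time spent in the
   configurations with [\sum_i n i < K].  When [n] is entered, worker [i] has
   been busy on its current mini-batch for some age which is independent of that
   computation time, so, by the new-longer-than-used property applied to one
   worker at a time,
     Pr (the time spent in n exceeds r) <= Pr (X_{1:P} > r) * Pr (n is visited).
   Integrating over [r], the expected time spent in [n] is at most
   [E[X_{1:P}] * Pr (n is visited)].  Almost surely, at most one configuration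
   with [\sum_i n i = k] is visited, and there are [K] values of [k]. *)
Require Import Defs.
From HB Require Import structures.
From mathcomp Require Import all_boot all_order all_algebra.
From mathcomp Require Import all_classical all_reals all_analysis.
From mathcomp Require Import measurable_realfun.
Set Implicit Arguments.
Unset Strict Implicit.
Unset Printing Implicit Defensive.
Import Order.TTheory GRing.Theory Num.Theory.
Local Open Scope classical_set_scope.
Local Open Scope ring_scope.
Local Open Scope ereal_scope.

(** * Generalities on measures, measurability and tail integrals *)

(* No measurability is needed because the integral of a nonnegative function is
   defined as a supremum over the simple functions below it. *)
Lemma ge0_le_integral_nomeas (d : measure_display) (T : measurableType d)
    (R : realType) (mu : {measure set T -> \bar R}) (f g : T -> \bar R) :
  (forall x, 0 <= f x) -> (forall x, f x <= g x) ->
  \int[mu]_x f x <= \int[mu]_x g x.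
Proof.
move=> f0 fg; have g0 x : 0 <= g x by exact: le_trans (f0 x) (fg x).
rewrite !ge0_integralTE//; apply: ereal_sup_le => _ [h /= hf <-].
by exists h => // x; exact: le_trans (hf x) (fg x).
Qed.

Lemma measure_bigsetU_le (d : measure_display) (T : measurableType d)
    (R : realType) (mu : {measure set T -> \bar R}) (I : Type) (s : seq I)
    (Q : pred I) (F : I -> set T) :
  (forall i, measurable (F i)) ->
  mu (\big[setU/set0]_(i <- s | Q i) F i) <= \sum_(i <- s | Q i) mu (F i).
Proof.
move=> mF; elim: s => [|i s IHs]; first by rewrite !big_nil measure0.
rewrite !big_cons; case: ifP => // _.
apply: (le_trans (measureU2 _ _ _)) => //; first exact: bigsetU_measurable.
by rewrite leeD2l.
Qed.

Lemma counting_ge_size (T : choiceType) (R : realType) (A : set T)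
    (s : seq T) : uniq s -> (forall x, x \in s -> A x) ->
  (size s)%:R%:E <= counting A :> \bar R.
Proof.
move=> us sA; rewrite /counting; case: asboolP => finA; last by rewrite leey.
rewrite lee_fin ler_nat; apply: uniq_leq_size => // x /sA Ax.
by rewrite in_fset_set// inE.
Qed.

Section measurable_big_minmax.
Context (d : measure_display) (T : measurableType d) (R : realType).

Lemma measurable_bigmax (I : Type) (s : seq I) (f0 : T -> R) (f : I -> T -> R) :
  measurable_fun setT f0 -> (forall i, measurable_fun setT (f i)) ->
  measurable_fun setT (fun w => \big[Num.max/f0 w]_(i <- s) f i w).
Proof.
move=> mf0 mf; elim: s => [|i s IHs].
  by under eq_fun do rewrite big_nil.
by under eq_fun do rewrite big_cons; exact: measurable_maxr.
Qed.

Lemma measurable_bigmin (I : Type) (s : seq I) (f0 : T -> R) (f : I -> T -> R) :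
  measurable_fun setT f0 -> (forall i, measurable_fun setT (f i)) ->
  measurable_fun setT (fun w => \big[Num.min/f0 w]_(i <- s) f i w).
Proof.
move=> mf0 mf; elim: s => [|i s IHs].
  by under eq_fun do rewrite big_nil.
by under eq_fun do rewrite big_cons; exact: measurable_minr.
Qed.

Lemma measurable_lt_set (f g : T -> R) :
  measurable_fun setT f -> measurable_fun setT g ->
  measurable [set w | (f w < g w)%R].
Proof.
move=> mf mg; rewrite -[X in measurable X]setTI.
by have := measurable_fun_ltr mf mg; apply => //; exact: (measurable_set1 true).
Qed.

Lemma measurable_forall_finType (I : finType) (A : I -> set T) :
  (forall i, measurable (A i)) -> measurable [set w | forall i, A i w].
Proof.
move=> mA; rewrite [X in measurable X](_ : _ = \bigcap_(i in [set: I]) A i).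
  by apply: fin_bigcap_measurable => //; exact: finite_finset.
by apply/seteqP; split => w /= h i => [_|]; exact: h.
Qed.

End measurable_big_minmax.

(** The layer-cake formula for a bare function; the measurability of the tail is kept for the later
    manipulations of the integral. *)
Lemma expectation_tail (d : measure_display) (T : measurableType d)
    (R : realType) (Pr : probability T R) (f : T -> R) :
  measurable_fun setT f -> (forall w, 0 <= f w)%R ->
  measurable_fun setT (fun r : R => Pr [set w | (r < f w)%R]) /\
  'E_Pr[f] =
    \int[@lebesgue_measure R]_(r in `[0%R, +oo[) Pr [set w | (r < f w)%R].
Proof.
move=> mf f0; pose F : {RV Pr >-> R} := mfun_Sub (mem_set mf).
have FE r : ccdf F r = Pr [set w | (r < f w)%R].
  by congr (Pr _); apply/seteqP; split => w /=; rewrite in_itv/= andbT.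
split.
  by under eq_fun do rewrite -FE; exact: ccdf_measurable.
under eq_integral do rewrite -FE.
exact: (@ge0_expectation_ccdf _ _ _ _ F).
Qed.

(** Independence on rectangles makes the joint law the product of the two laws, so [W] can be frozen
    at [x] and then integrated out. *)
Lemma prob_independent_pair (d d1 d2 : measure_display)
    (Omega : measurableType d) (T1 : measurableType d1)
    (T2 : measurableType d2) (R : realType) (Pr : probability Omega R)
    (W : {mfun Omega >-> T1}) (Z : {mfun Omega >-> T2}) :
  (forall A B, measurable A -> measurable B ->
    Pr (W @^-1` A `&` Z @^-1` B) = Pr (W @^-1` A) * Pr (Z @^-1` B)) ->
  forall S : set (T1 * T2), measurable S ->
    Pr [set w | S (W w, Z w)] =
    \int[distribution Pr W]_x Pr [set w | S (x, Z w)].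
Proof.
move=> indep S mS.
have mWZ : measurable_fun setT (fun w => (W w, Z w)).
  exact: measurable_fun_pair.
pose WZ : {mfun Omega >-> (T1 * T2)%type} := mfun_Sub (mem_set mWZ).
transitivity (distribution Pr WZ S) => //.
rewrite -(@product_measure_unique _ _ _ _ _ (distribution Pr W)
  (distribution Pr Z) (distribution Pr WZ) indep S mS).
apply: eq_integral => x _ /=; congr (Pr _).
by apply/seteqP; split => w; rewrite /preimage /xsection/= inE.
Qed.

(** * Residual computation time after an independent random age *)

Section new_longer_than_used_aged.
Context (d : measure_display) (Omega : measurableType d) (R : realType)
  (Pr : probability Omega R).

Lemma new_longer_than_used_tail (Z : {RV Pr >-> R}) (t u : R) :
  new_longer_than_used Z -> (0 <= t)%R -> (0 <= u)%R ->
  Pr [set w | (t + u < Z w)%R] <=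
  Pr [set w | (u < Z w)%R] * Pr [set w | (t < Z w)%R].
Proof.
move=> [_ nlu] t0 u0; have mZ r : measurable [set w | (r < Z w)%R].
  exact: measurable_lt_set.
have sub : [set w | (u + t < Z w)%R] `<=` [set w | (t < Z w)%R].
  by move=> w /=; apply: le_lt_trans; rewrite lerDr.
(* When the conditioning event is null, the hypothesis says nothing, but the smaller event on the
   left is null too. *)
rewrite addrC; have [P0|P0] := eqVneq (Pr [set w | (t < Z w)%R]) 0.
  by rewrite P0 mule0 -P0 le_measure// inE.
have {}P0 : 0 < Pr [set w | (t < Z w)%R] by rewrite lt0e P0/=.
have := nlu t u t0 u0 P0.
rewrite /cond_prob (setIidl sub).
have pE := fineK (fin_num_measure Pr _ (mZ t)).
have p0 : (0 < fine (Pr [set w | (t < Z w)%R]))%R by rewrite -lte_fin pE.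
by rewrite -pE inver gt_eqF// lee_pdivrMr.
Qed.

(** Once [W] is frozen at [x], the age [a x] is a constant and the tail inequality applies;
    integrating over the law of [W] concludes. *)
Lemma new_longer_than_used_aged (d1 : measure_display)
    (T1 : measurableType d1) (W : {mfun Omega >-> T1}) (Z : {RV Pr >-> R})
    (A : set T1) (a : T1 -> R) (u : R) :
  (forall C B, measurable C -> measurable B ->
    Pr (W @^-1` C `&` Z @^-1` B) = Pr (W @^-1` C) * Pr (Z @^-1` B)) ->
  new_longer_than_used Z -> measurable A -> measurable_fun setT a ->
  (forall x, 0 <= a x)%R -> (0 <= u)%R ->
  Pr [set w | A (W w) /\ (a (W w) + u < Z w)%R] <=
  Pr [set w | (u < Z w)%R] * Pr [set w | A (W w) /\ (a (W w) < Z w)%R].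
Proof.
move=> indep nlu mA ma a0 u0.
(* The shift [v] is a parameter so that [v = u] and [v = 0] give the two sides of the inequality. *)
pose S (v : R) : set (T1 * R) := (A `*` setT) `&` [set x | (a x.1 + v < x.2)%R].
have mS v : measurable (S v).
  apply: measurableI; first exact: measurableX.
  apply: measurable_lt_set => //; apply: measurable_funD => //.
  exact: measurableT_comp.
have SE v x : Pr [set w | S v (x, Z w)] =
    Pr [set w | A x /\ (a x + v < Z w)%R].
  by congr (Pr _); apply/seteqP; split => w [] /=; [move=> []|].
have S_W v : Pr [set w | A (W w) /\ (a (W w) + v < Z w)%R] =
    \int[distribution Pr W]_x Pr [set w | S v (x, Z w)].
  rewrite -prob_independent_pair//; congr (Pr _).
  by apply/seteqP; split => w [] /=; [|move=> []].
have mPS v : measurable_fun setT (fun x => Pr [set w | S v (x, Z w)]).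
  have := measurable_fun_xsection (distribution Pr Z) (mS v).
  apply: eq_measurable_fun => x _ /=; congr (Pr _).
  by apply/seteqP; split => w; rewrite /preimage /xsection/= inE.
have -> : [set w | A (W w) /\ (a (W w) < Z w)%R] =
    [set w | A (W w) /\ (a (W w) + 0 < Z w)%R].
  by apply: eq_set => w; rewrite addr0.
rewrite !S_W -ge0_integralZl//.
apply: ge0_le_integral_nomeas => // x; rewrite !SE.
have [Ax|nAx] := pselect (A x); last first.
  rewrite [X in Pr X](_ : _ = set0) ?measure0 ?mule_ge0//.
  by apply/seteqP; split => w [].
have cond v : [set w | A x /\ (a x + v < Z w)%R] = [set w | (a x + v < Z w)%R].
  by apply/seteqP; split => w // [].
by rewrite !cond addr0; exact: new_longer_than_used_tail.
Qed.

End new_longer_than_used_aged.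

(** * The sigma-algebra generated by all variables but one *)

Section avoiding_sigma_algebra.
Context (d : measure_display) (Omega : measurableType d) (R : realType)
  (Pr : probability Omega R) (I : eqType) (X : I -> {RV Pr >-> R}).

(** A pi-system generating the sigma-algebra of the variables other than [X i0]; lists are
    duplicate-free to match [mutually_independent]. *)
Definition cylinders_avoiding (i0 : I) : set (set Omega) :=
  [set A | exists (s : seq I) (B : I -> set R),
    [/\ uniq s, i0 \notin s, forall i, measurable (B i) &
        A = [set w | forall i, i \in s -> B i (X i w)]]].

Notation sigma_avoiding i0 := (g_sigma_algebraType (cylinders_avoiding i0)).

Lemma measurable_cylinder (s : seq I) (B : I -> set R) :
  (forall i, measurable (B i)) ->
  measurable [set w | forall i, i \in s -> B i (X i w)].
Proof.
move=> mB; elim: s => [|i s IHs].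
  by rewrite [X in measurable X](_ : _ = setT)//; apply/seteqP; split.
rewrite [X in measurable X](_ : _ = X i @^-1` B i `&`
    [set w | forall j, j \in s -> B j (X j w)]).
  apply: measurableI => //.
  by rewrite -[X in measurable X]setTI; exact: measurable_funP.
apply/seteqP; split => w /=.
  by move=> h; split => [|j js]; apply: h; rewrite in_cons ?eqxx// js orbT.
by move=> [hi hs] j; rewrite in_cons => /predU1P[->|/hs].
Qed.

Lemma cylinders_avoiding_measurable i0 :
  cylinders_avoiding i0 `<=` measurable.
Proof. by move=> _ [s [B [_ _ mB ->]]]; exact: measurable_cylinder. Qed.

Lemma sigma_avoiding_measurable i0 (A : set Omega) :
  <<s cylinders_avoiding i0 >> A -> measurable A.
Proof.
apply: smallest_sub; first exact: sigma_algebra_measurable.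
exact: cylinders_avoiding_measurable.
Qed.

Lemma cylinders_avoiding_setI i0 : setI_closed (cylinders_avoiding i0).
Proof.
move=> _ _ [s [B [us i0s mB ->]]] [t [C [ut i0t mC ->]]].
exists (undup (s ++ t)), (fun i => (if i \in s then B i else setT) `&`
                                   (if i \in t then C i else setT)).
split; first exact: undup_uniq.
- by rewrite mem_undup mem_cat negb_or i0s i0t.
- by move=> i; apply: measurableI; case: ifP.
- apply/seteqP; split => w /=.
    move=> [hs ht] i _; split; case: ifP => //; [exact: hs|exact: ht].
  move=> h; split => i iin; have := h i; rewrite mem_undup mem_cat iin ?orbT.
    by move=> /(_ isT)[].
  by move=> /(_ isT)[].
Qed.

Lemma measurable_sigma_avoiding i0 i : i != i0 ->
  measurable_fun (setT : set (sigma_avoiding i0)) (X i).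
Proof.
move=> ii0 _ B mB; rewrite setTI; apply: sub_sigma_algebra.
exists [:: i], (fun=> B); split => //; first by rewrite inE eq_sym.
apply/seteqP; split => w /=; first by move=> Bw j; rewrite inE => /eqP ->.
by apply; rewrite mem_head.
Qed.

(** As functions of [A], both sides are finite measures; they agree on the cylinders, a pi-system,
    hence on the sigma-algebra it generates. *)
Lemma independent_sigma_avoiding i0 (A : set Omega) (B : set R) :
  mutually_independent X -> <<s cylinders_avoiding i0 >> A -> measurable B ->
  Pr (A `&` X i0 @^-1` B) = Pr A * Pr (X i0 @^-1` B).
Proof.
move=> indep sA mB.
have mXB : measurable (X i0 @^-1` B).
  by rewrite -[X in measurable X]setTI; exact: measurable_funP.
pose r := NngNum (fine_ge0 (measure_ge0 Pr (X i0 @^-1` B))).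
have rE : r%:num%:E = Pr (X i0 @^-1` B) by rewrite /= fineK// fin_num_measure.
suff : mrestr Pr mXB A = mscale r Pr A by rewrite /mscale /mrestr rE muleC.
apply: (@g_sigma_algebra_measure_unique _ _ _ _
  (@cylinders_avoiding_measurable i0) (fun=> setT)) sA.
- move=> n; exists [::], (fun=> setT); split => //.
  by apply/seteqP; split.
- by rewrite bigcup_const//; exists 0%N.
- exact: cylinders_avoiding_setI.
- move=> C [s [D [us i0s mD ->]]].
  rewrite -[RHS]/(r%:num%:E * _) rE -[LHS]/(Pr (_ `&` _)).
  (* [E] merges [B] at [i0] with the constraints [D] on [s], so that the product rule over [i0 :: s]
     splits off the factor of [i0]. *)
  pose E i := if i == i0 then B else D i.
  have mE i : measurable (E i) by rewrite /E; case: ifP.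
  have ED i : i \in s -> E i = D i.
    by move=> iin; rewrite /E; case: eqP iin i0s => // -> ->.
  have := indep (i0 :: s) E; rewrite /= us i0s => /(_ isT mE).
  rewrite big_cons {2}/E eqxx => indepE.
  transitivity (Pr [set w | forall i, i \in i0 :: s -> E i (X i w)]).
    congr (Pr _); apply/seteqP; split => w /=.
      move=> [hs hB] i; rewrite in_cons => /predU1P[->|iin].
        by rewrite /E eqxx.
      by rewrite ED//; exact: hs.
    move=> h; split => [i iin|].
      by rewrite -ED//; apply: h; rewrite in_cons iin orbT.
    by have := h i0; rewrite mem_head /E eqxx; apply.
  rewrite indepE; congr (_ * _); rewrite indep//.
  by apply: eq_big_seq => i iin; rewrite ED.
- by move=> _; rewrite -ge0_fin_numE// fin_num_measure.
Qed.

(* Induction on the number of indices at which [u] is added to the age: the other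
   variables and all the ages are independent of the variable being treated. *)
Lemma new_longer_than_used_aged_family (J : finType) (j : J -> I)
    (a : J -> Omega -> R) (u : R) :
  mutually_independent X -> (forall i, new_longer_than_used (X i)) ->
  injective j ->
  (forall i k, measurable_fun (setT : set (sigma_avoiding (j i))) (a k)) ->
  (forall k w, 0 <= a k w)%R -> (0 <= u)%R ->
  Pr [set w | forall k, (a k w + u < X (j k) w)%R] <=
  (\prod_(k : J) Pr [set w | (u < X (j k) w)%R]) *
  Pr [set w | forall k, (a k w < X (j k) w)%R].
Proof.
move=> indep nlu jinj ma a0 u0.
suff main (s : seq J) : uniq s ->
    Pr [set w | forall k, (a k w + (if k \in s then u else 0) < X (j k) w)%R] <=
    (\prod_(k <- s) Pr [set w | (u < X (j k) w)%R]) *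
    Pr [set w | forall k, (a k w < X (j k) w)%R].
  have := main _ (index_enum_uniq J).
  rewrite [X in Pr X <= _](_ : _ =
    [set w | forall k, (a k w + u < X (j k) w)%R])//.
  by apply: eq_set => w; apply: eq_forall => k; rewrite mem_index_enum.
elim: s => [_|i s IHs /= /andP[i0s us]].
  rewrite big_nil mul1e.
  rewrite [X in Pr X <= _](_ : _ = [set w | forall k, (a k w < X (j k) w)%R])//.
  by apply: eq_set => w; apply: eq_forall => k; rewrite in_nil addr0.
pose c k : R := if k \in s then u else 0%R.
(* [W] is the identity into [Omega] with the smaller sigma-algebra: it carries everything that does
   not involve [X (j i)], namely all the ages and the other variables. *)
have idm : measurable_fun setT (id : Omega -> sigma_avoiding (j i)).
  move=> _ A; rewrite setTI; exact: sigma_avoiding_measurable.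
pose W : {mfun Omega >-> sigma_avoiding (j i)} := mfun_Sub (mem_set idm).
pose A : set (sigma_avoiding (j i)) :=
  [set w | forall k, k != i -> (a k w + c k < X (j k) w)%R].
have mA : measurable A.
  apply: measurable_forall_finType => k; have [->|ki] := eqVneq k i.
    rewrite [X in measurable X](_ : _ = setT)//.
    by apply/seteqP; split => // w _ /=; rewrite ?eqxx.
  have := @measurable_lt_set _ (sigma_avoiding (j i)) R
    (fun w => a k w + c k)%R (X (j k)).
  set C := [set w | _] => mC.
  rewrite [X in measurable X](_ : _ = C); last first.
    by apply/seteqP; split => w /=; [apply|move=> ? _].
  apply: mC; first exact: measurable_funD.
  by apply: measurable_sigma_avoiding; rewrite (inj_eq jinj).
have step := @new_longer_than_used_aged _ _ _ Pr _ _ W (X (j i)) A (a i) u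
  (fun C B mC mB => independent_sigma_avoiding indep mC mB)
  (nlu _) mA (ma i i) (a0 i) u0.
rewrite big_cons -muleA.
have -> : [set w | forall k,
      (a k w + (if k \in i :: s then u else 0) < X (j k) w)%R] =
    [set w | A (W w) /\ (a i (W w) + u < X (j i) w)%R].
  apply/seteqP; split => w /=.
    move=> h; split => [k ki|]; have := h; last by move=> /(_ i); rewrite mem_head.
    by move=> /(_ k); rewrite in_cons (negPf ki).
  move=> [hA hi] k; rewrite in_cons; have [->//|ki] := eqVneq k i.
  exact: hA.
apply: (le_trans step); apply: lee_pmul => //.
(* Since [i] is not in [s], the unshifted condition on [i] completes [A] to the event of the
   induction hypothesis. *)
apply: le_trans (IHs us); rewrite le_eqVlt; apply/orP; left; apply/eqP.
congr (Pr _); apply/seteqP; split => w /=.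
  move=> [hA hi] k; have [->|ki] := eqVneq k i; last exact: hA.
  by rewrite (negPf i0s) addr0.
move=> h; split => [k _|]; first exact: h.
by have := h i; rewrite (negPf i0s) addr0.
Qed.

End avoiding_sigma_algebra.

(** * Configurations along one fixed table of computation times *)

Section configurations.
Context (R : realType) (P : nat) (x : 'I_P -> nat -> R).
Implicit Types n : 'I_P -> nat.

Definition elapsed (i : 'I_P) (k : nat) : R := (\sum_(l < k) x i l)%R.

Lemma elapsedS i k : elapsed i k.+1 = (elapsed i k + x i k)%R.
Proof. by rewrite /elapsed big_ord_recr. Qed.

(* If the process is ever in the configuration in which worker [i] has finished
   exactly [n i] mini-batches, this is when it enters it. *)
Definition config_start n : R :=
  (\big[Num.max/0]_(i < P) elapsed i (n i))%R.

Definition age n (i : 'I_P) : R := (config_start n - elapsed i (n i))%R.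

(* Time spent in the configuration [n], which is [0] if it is never visited; the
   index [i0] only witnesses that there is at least one worker. *)
Definition config_length n (i0 : 'I_P) : R :=
  Num.max 0%R (\big[Num.min/(x i0 (n i0) - age n i0)%R]_(i < P)
    (x i (n i) - age n i)%R).

Lemma age_ge0 n i : (0 <= age n i)%R.
Proof. by rewrite subr_ge0; exact: le_bigmax. Qed.

Lemma config_length_gtP n i0 (r : R) : (0 <= r)%R ->
  (r < config_length n i0)%R <-> forall i, (age n i + r < x i (n i))%R.
Proof.
move=> r0; rewrite /config_length lt_max ltNge r0 /=; split.
  by move=> /bigmin_gtP[_ h] i; rewrite -ltrBrDl h.
by move=> h; apply/bigmin_gtP; split => [|i _]; rewrite ltrBrDl.
Qed.

(** Take for [n i] the least [j] whose mini-batch is unfinished at [t]: all earlier ones are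
    finished, so their total number is below [K]. *)
Lemma num_finished_config (K : nat) (t : R) : (0 <= t)%R ->
  ~ (K%:R%:E <= num_finished x t) ->
  exists n : {ffun 'I_P -> 'I_K}, (\sum_i n i < K)%N /\
    forall i, (elapsed i (n i) <= t < elapsed i (n i).+1)%R.
Proof.
move=> t0 notK.
have small (s : seq ('I_P * nat)) : uniq s ->
    (forall ij, ij \in s -> (elapsed ij.1 ij.2.+1 <= t)%R) -> (size s < K)%N.
  move=> us st; rewrite ltnNge; apply/negP => Ks; apply: notK.
  apply: le_trans (counting_ge_size R us st).
  by rewrite lee_fin ler_nat.
(* Otherwise worker [i] alone would have finished [K] mini-batches by time [t]. *)
have exj i : exists j, (t < elapsed i j.+1)%R.
  apply: contrapT => /forallNP noj.
  suff : (size [seq (i, j) | j <- iota 0 K] < K)%N.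
    by rewrite size_map size_iota ltnn.
  apply: small; first by rewrite map_inj_uniq ?iota_uniq// => j k [].
  by move=> _ /mapP[j _ ->]/=; rewrite leNgt; apply/negP/noj.
pose m i := ex_minn (exj i).
have m_gt i : (t < elapsed i (m i).+1)%R by rewrite /m; case: ex_minnP.
have m_le i j : (j < m i)%N -> (elapsed i j.+1 <= t)%R.
  rewrite /m; case: ex_minnP => k _ kmin jk; rewrite leNgt; apply/negP => /kmin.
  by rewrite leqNgt jk.
have summ : (\sum_i m i < K)%N.
  pose s := [seq (i, j) | i <- enum 'I_P, j <- iota 0 (m i)].
  have <- : size s = (\sum_i m i)%N.
    rewrite size_allpairs_dep sumnE big_map big_enum.
    by apply: eq_bigr => i _; rewrite size_iota.
  apply: small.
    apply: allpairs_uniq_dep; [exact: enum_uniq|by move=> *; exact: iota_uniq|].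
    by move=> [i j] [k l] _ _ /= [-> ->].
  move=> _ /allpairsPdep[i [j [_ + ->]]]/=.
  by rewrite mem_iota add0n => /andP[_ /m_le].
have mK i : (m i < K)%N.
  by apply: leq_ltn_trans summ; rewrite (bigD1 i)//= leq_addr.
exists [ffun i => Ordinal (mK i)]; split.
  by under eq_bigr do rewrite ffunE.
move=> i; rewrite ffunE/= m_gt andbT.
(* For [m i = 0] the elapsed time is the empty sum, and [0 <= t] is what is needed. *)
by have := m_le i; case: (m i) => [_|j]; [rewrite /elapsed big_ord0|apply].
Qed.

(** Every time in [[0, T[] lies in the stay interval of some configuration of total below [K];
    comparing Lebesgue measures gives the bound, whatever the signs of the times. *)
Lemma iteration_runtime_le (K : nat) (i0 : 'I_P) :
  (iteration_runtime x K <=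
   \sum_(n : {ffun 'I_P -> 'I_K} | (\sum_i n i < K)%N)
     config_length (fun i => n i) i0)%R.
Proof.
pose len (n : {ffun 'I_P -> 'I_K}) := config_length (fun i => n i) i0.
have len0 (n : {ffun 'I_P -> 'I_K}) : (0 <= len n)%R by rewrite le_max lexx.
(* This branch includes the case where [K] mini-batches are never finished: the infimum of the empty
   set is [0]. *)
have [T0|T0] := leP (iteration_runtime x K) 0%R.
  by apply: (le_trans T0); apply: sumr_ge0 => n _; exact: len0.
pose V (n : {ffun 'I_P -> 'I_K}) : set R :=
  `[config_start (fun i => n i), (config_start (fun i => n i) + len n)%R[%classic.
pose mu := @lebesgue_measure R.
have muV (n : {ffun 'I_P -> 'I_K}) : mu (V n) = (len n)%:E.
  rewrite /mu /V lebesgue_measure_itv/= lte_fin ltrDl.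
  case: ltP => [_|l0]; first by rewrite -EFinB addrAC subrr add0r.
  by congr _%:E; apply/le_anti; rewrite l0 len0.
rewrite -lee_fin -sumEFin.
have -> : (iteration_runtime x K)%:E =
    mu (`[0%R, iteration_runtime x K[%classic : set R).
  by rewrite /mu lebesgue_measure_itv/= lte_fin T0 sube0.
under [leRHS]eq_bigr do rewrite -/(len _) -muV.
apply: le_trans (measure_bigsetU_le _ _ _ _); last first.
  by move=> n; exact: measurable_itv.
apply: le_measure; rewrite ?inE//.
  by apply: bigsetU_measurable => n _; exact: measurable_itv.
move=> t /=; rewrite in_itv/= => /andP[t0 tT].
have [n [nK nt]] : exists n : {ffun 'I_P -> 'I_K}, (\sum_i n i < K)%N /\
    forall i, (elapsed i (n i) <= t < elapsed i (n i).+1)%R.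
  apply: num_finished_config => // Kt.
  suff : (iteration_runtime x K <= t)%R by rewrite leNgt tT.
  by apply: ge_inf => //; exists 0%R => s [].
rewrite -bigcup_seq_cond/=; exists n; first by rewrite /= mem_index_enum.
have start_le : (config_start (fun i => n i) <= t)%R.
  by apply/bigmax_leP; split => // i _; case/andP: (nt i).
rewrite /V /= in_itv/= start_le /= -ltrBlDl.
apply/config_length_gtP; first by rewrite subr_ge0.
move=> i; have /andP[_] := nt i; rewrite elapsedS /age.
by rewrite [X in _ -> (X < _)%R]addrC subrKA ltrBlDl.
Qed.

(** Two visited configurations are comparable coordinatewise, and comparable vectors with equal sums
    coincide. *)
Lemma visited_configs_eq (n n' : 'I_P -> nat) :
  (forall i l, 0 <= x i l)%R -> (\sum_i n i = \sum_i n' i)%N ->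
  (forall i, age n i < x i (n i))%R -> (forall i, age n' i < x i (n' i))%R ->
  n =1 n'.
Proof.
have visited m i j : (forall i, age m i < x i (m i))%R ->
    (elapsed j (m j) < elapsed i (m i).+1)%R.
  move=> /(_ i); rewrite ltrBlDl -elapsedS; apply: le_lt_trans.
  exact: le_bigmax.
move=> x0 sumE vn vn'.
have mono i k l : (k <= l)%N -> (elapsed i k <= elapsed i l)%R.
  move=> /subnKC <-; elim: (l - k)%N => [|m IHm]; first by rewrite addn0.
  by rewrite addnS elapsedS (le_trans IHm)// lerDl.
(* The completion of [n i] by [i] would come no later than entry [n' i], strictly before [j]
   completes [n' j], hence before [j] has finished [n j] mini-batches, and so before itself. *)
have lt_absurd i j : (n i < n' i)%N -> (n' j < n j)%N -> False.
  move=> ni nj; have := visited n i j vn; apply/negP; rewrite -leNgt.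
  apply: le_trans (mono _ _ _ ni) _.
  by apply: le_trans (mono _ _ _ nj); rewrite ltW//; exact: visited.
have eq_of_le (m m' : 'I_P -> nat) : (forall i, m i <= m' i)%N ->
    (\sum_i m i = \sum_i m' i)%N -> m =1 m'.
  move=> le_m /eqP sum_m j.
  have [_ eq_all] := leqif_sum (fun i (_ : true) => leqif_eq (le_m i)).
  by move: sum_m; rewrite eq_all => /forallP/(_ j)/eqP.
have [/existsP[i ni]|/existsPn n'_le] := boolP [exists i, n i < n' i]%N.
  apply: eq_of_le => // j.
  by rewrite leqNgt; apply/negP => /(lt_absurd _ _ ni).
by apply: fsym; apply: eq_of_le => // i; rewrite leqNgt n'_le.
Qed.

End configurations.

Lemma sum_prob_disjoint_le1 (d : measure_display) (Omega : measurableType d)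
    (R : realType) (Pr : probability Omega R) (I : finType) (Q : pred I)
    (V : I -> set Omega) :
  (forall i, measurable (V i)) ->
  (forall i j w, Q i -> Q j -> V i w -> V j w -> i = j) ->
  \sum_(i | Q i) Pr (V i) <= 1.
Proof.
move=> mV V_eq.
suff -> : \sum_(i | Q i) Pr (V i) = Pr (\big[setU/set0]_(i | Q i) V i).
  by apply: probability_le1; exact: bigsetU_measurable.
elim: (index_enum I) (index_enum_uniq I) => [|i s IHs] /=.
  by rewrite !big_nil measure0.
move=> /andP[si us]; rewrite !big_cons; case: ifP => Qi; last exact: IHs.
rewrite IHs// measureU//; first exact: bigsetU_measurable.
apply/seteqP; split => // w [Vi]; rewrite -bigcup_seq_cond => -[k /=].
by move=> /andP[ks Qk] Vk; rewrite (V_eq i k w)// ks in si.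
Qed.

(** * Expected time per configuration, and summation *)

Section batch_sync.
Context (R : realType) (P : nat) (d : measure_display)
  (Omega : measurableType d) (Pr : probability Omega R)
  (X : 'I_P -> nat -> {RV Pr >-> R})
  (X_iid : iid (fun ij : 'I_P * nat => X ij.1 ij.2))
  (X_nlu : forall i j, new_longer_than_used (X i j)).

Let XX (ij : 'I_P * nat) := X ij.1 ij.2.
Let times w (i : 'I_P) (j : nat) : R := X i j w.

Lemma measurable_age (n : 'I_P -> nat) i k :
  measurable_fun
    (setT : set (g_sigma_algebraType (cylinders_avoiding XX (i, n i))))
    (fun w => age (times w) n k).
Proof.
have melapsed j : measurable_fun
    (setT : set (g_sigma_algebraType (cylinders_avoiding XX (i, n i))))
    (fun w => elapsed (times w) j (n j)).
  apply: measurable_sum => l.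
  apply: (@measurable_sigma_avoiding _ _ _ _ _ XX (i, n i) (j, l : nat)).
  (* Ages only involve mini-batches [l < n j], never the current one [n j]. *)
  apply/eqP => -[ji lE]; have := ltn_ord l.
  by rewrite lE ji ltnn.
apply: measurable_funB => //.
by apply: measurable_bigmax => //; exact: measurable_cst.
Qed.

Lemma prob_config_length_gt (n : 'I_P -> nat) (i0 : 'I_P) (r : R) :
  (0 <= r)%R ->
  Pr [set w | (r < config_length (times w) n i0)%R] <=
  (\prod_(k < P) Pr [set w | (r < X k (n k) w)%R]) *
  Pr [set w | forall k, (age (times w) n k < X k (n k) w)%R].
Proof.
move=> r0.
have -> : [set w | (r < config_length (times w) n i0)%R] =
    [set w | forall k, (age (times w) n k + r < X k (n k) w)%R].
  apply/seteqP; split => w /=; first by move/(config_length_gtP _ _ _ r0).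
  by move=> h; apply/(config_length_gtP _ _ _ r0).
apply: (@new_longer_than_used_aged_family _ _ _ _ _ XX 'I_P
  (fun k => (k, n k)) (fun k w => age (times w) n k)) => //.
- exact: X_iid.1.
- by move=> ij; exact: X_nlu.
- by move=> k l [].
- by move=> i k; exact: measurable_age.
- by move=> k w; exact: age_ge0.
Qed.

Lemma measurable_age_full (n : 'I_P -> nat) k :
  measurable_fun setT (fun w => age (times w) n k).
Proof.
move=> _ B mB; have := @measurable_age n k k measurableT B mB.
exact: sigma_avoiding_measurable.
Qed.

Lemma measurable_config_length (n : 'I_P -> nat) (i0 : 'I_P) :
  measurable_fun setT (fun w => config_length (times w) n i0).
Proof.
apply: measurable_maxr; first exact: measurable_cst.
by apply: measurable_bigmin => [|i]; apply: measurable_funB => //;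
  exact: measurable_age_full.
Qed.

Lemma measurable_visited (n : 'I_P -> nat) :
  measurable [set w | forall k, (age (times w) n k < X k (n k) w)%R].
Proof.
apply: measurable_forall_finType => k.
by apply: measurable_lt_set => //; exact: measurable_age_full.
Qed.

(** Off the null set [N] of negative times, visited configurations of equal total coincide, so the
    events are disjoint. *)
Lemma sum_prob_visited_le (K k : nat) :
  \sum_(n : {ffun 'I_P -> 'I_K} | (\sum_i n i == k)%N)
    Pr [set w | forall i, (age (times w) (fun i => n i) i < X i (n i) w)%R]
  <= 1.
Proof.
have [N [mN N0 subN]] : {ae Pr, forall w, forall i l, (0 <= X i l w)%R}.
  by apply: filter_forall => i; apply: ae_foralln => l; exact: (X_nlu i l).1.
pose V (n : {ffun 'I_P -> 'I_K}) :=
  [set w | forall i, (age (times w) (fun i => n i) i < X i (n i) w)%R].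
have mV n : measurable (V n) by exact: measurable_visited.
have mVN n : measurable (V n `\` N) by exact: measurableD.
apply: (@le_trans _ _ (\sum_(n : {ffun 'I_P -> 'I_K} | (\sum_i n i == k)%N)
    Pr (V n `\` N))).
  apply: lee_sum => n _; rewrite -[leRHS]adde0 -N0.
  apply: le_trans (measureU2 _ _ _) => //.
  apply: le_measure; rewrite ?inE//; first exact: mV.
    exact: measurableU.
  by move=> w Vw; have [Nw|Nw] := pselect (N w); [right|left].
apply: sum_prob_disjoint_le1 => // n n' w /eqP nk /eqP n'k [Vn Nw] [Vn' _].
have x0 i l : (0 <= times w i l)%R.
  by apply: contrapT => nonneg; apply: Nw; apply: subN => /(_ i l).
have E := @visited_configs_eq _ _ (times w) (fun i => n i) (fun i => n' i) x0
  (etrans nk (esym n'k)) Vn Vn'.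
by apply/ffunP => i; apply/val_inj; exact: E.
Qed.

Context (d' : measure_display) (Omega' : measurableType d')
  (Pr' : probability Omega' R) (Y : 'I_P -> {RV Pr' >-> R}) (Y_iid : iid Y)
  (Y_copy : forall i j k, identically_distributed (Y k) (X i j)).

(** Only the law of [Y k] is known, so the event of negativity is transported to [X k 0]. *)
Lemma copy_ge0 : {ae Pr', forall w, forall k, (0 <= Y k w)%R}.
Proof.
apply: filter_forall => k; exists [set w | (Y k w < 0)%R]; split.
- exact: measurable_lt_set.
- have m0 : measurable [set z : R | (z < 0)%R] by exact: measurable_lt_set.
  transitivity (Pr [set w | (X k 0%N w < 0)%R]); first exact: (Y_copy k 0%N k m0).
  apply: measure_negligible; first exact: measurable_lt_set.
  apply: negligibleS (X_nlu k 0%N).1 => w /=.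
  by rewrite /preimage/= ltNge => /negP.
- by move=> w /= /negP; rewrite -ltNge.
Qed.

Let minY (i0 : 'I_P) w : R := \big[Num.min/Y i0 w]_(i < P) Y i w.

Let measurable_minY i0 : measurable_fun setT (minY i0).
Proof. exact: measurable_bigmin. Qed.

Let mpos i0 w : R := Num.max 0%R (minY i0 w).

Let measurable_mpos i0 : measurable_fun setT (mpos i0).
Proof. by apply: measurable_maxr => //; exact: measurable_cst. Qed.

(** The tail formula wants nonnegativity everywhere, while the minimum is nonnegative only almost
    surely; hence the truncation [mpos]. *)
Lemma expectation_min_pos i0 : 'E_Pr'[minY i0] = 'E_Pr'[mpos i0].
Proof.
rewrite unlock; apply: ae_eq_integral => //.
- exact/measurable_EFinP.
- exact/measurable_EFinP.
apply: filterS copy_ge0 => w Y0 _; congr _%:E.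
by apply/esym/max_idPr/bigmin_geP; split.
Qed.

Lemma prob_min_gt (n : 'I_P -> nat) i0 (r : R) : (0 <= r)%R ->
  Pr' [set w | (r < mpos i0 w)%R] =
  \prod_(k < P) Pr [set w | (r < X k (n k) w)%R].
Proof.
move=> r0; have mB : measurable [set z : R | (r < z)%R].
  exact: measurable_lt_set.
transitivity (\prod_(k < P) Pr' [set w | (r < Y k w)%R]); last first.
  by apply: eq_bigr => k _; exact: (Y_copy k (n k) k mB).
rewrite -(Y_iid.1 (index_enum 'I_P) (fun=> [set z : R | (r < z)%R])
  (index_enum_uniq _) (fun=> mB)).
congr (Pr' _); apply/seteqP; split => w /=; rewrite lt_max ltNge r0 /=.
  by move=> /bigmin_gtP[_ h] i _; exact: h.
by move=> h; apply/bigmin_gtP; split => [|i _]; apply: h; rewrite mem_index_enum.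
Qed.

(** Integrates the tail bound over [r]; the probability of a visit does not depend on [r]. *)
Lemma expectation_config_length_le (n : 'I_P -> nat) (i0 : 'I_P) :
  'E_Pr[fun w => config_length (times w) n i0] <=
  Pr [set w | forall k, (age (times w) n k < X k (n k) w)%R] *
  'E_Pr'[minY i0].
Proof.
rewrite expectation_min_pos.
have len0 w : (0 <= config_length (times w) n i0)%R by rewrite le_max lexx.
have mpos0 w : (0 <= mpos i0 w)%R by rewrite le_max lexx.
have [mL ->] := expectation_tail Pr (measurable_config_length n i0) len0.
have [mM ->] := expectation_tail Pr' (measurable_mpos i0) mpos0.
rewrite -ge0_integralZl//; last exact: measurable_funTS.
apply: ge0_le_integral => //.
- exact: measurable_funTS.
- by apply: emeasurable_funM; [exact: measurable_cst|exact: measurable_funTS].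
move=> r /=; rewrite in_itv/= andbT => r0.
by rewrite (prob_min_gt n)// muleC; exact: prob_config_length_gt.
Qed.

Lemma expectation_iteration_runtime_le (K : nat) (i0 : 'I_P) :
  'E_Pr[fun w => iteration_runtime (times w) K] <= K%:R%:E * 'E_Pr'[minY i0].
Proof.
have EY0 : 0 <= 'E_Pr'[minY i0].
  by rewrite expectation_min_pos expectation_ge0// => w; rewrite le_max lexx.
have T0 w : (0 <= iteration_runtime (times w) K)%R.
  rewrite /iteration_runtime; set A := [set _ | _].
  have [->|A0] := eqVneq A set0; first by rewrite inf0.
  by apply: lb_le_inf; [exact/set0P|move=> t []].
pose Ind := {ffun 'I_P -> 'I_K}.
pose c (n : Ind) : nat := (\sum_i n i)%N.
pose L (n : Ind) w := config_length (times w) (fun i => n i) i0.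
have L0 n w : (0 <= L n w)%R by rewrite le_max lexx.
pose V (n : Ind) :=
  [set w | forall i, (age (times w) (fun i => n i) i < X i (n i) w)%R].
apply: (@le_trans _ _ (\sum_(n | (c n < K)%N) 'E_Pr[L n])).
  rewrite unlock -big_filter -ge0_integral_sum//.
  (* This comparison avoids having to show that the runtime is measurable. *)
  - apply: ge0_le_integral_nomeas => w; first by rewrite lee_fin.
    rewrite big_filter sumEFin lee_fin; exact: iteration_runtime_le.
  - by move=> n; apply/measurable_EFinP; exact: measurable_config_length.
  - by move=> n w _; rewrite lee_fin.
apply: (@le_trans _ _ (\sum_(n | (c n < K)%N) Pr (V n) * 'E_Pr'[minY i0])).
  by apply: lee_sum => n _; exact: expectation_config_length_le.
rewrite -ge0_sume_distrl//; apply: lee_pmul => //.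
  by apply: sume_ge0.
have -> : K%:R%:E = \sum_(k < K) (1 : \bar R).
  by rewrite sumEFin sumr_const card_ord.
(* Configurations are grouped by their total [k < K]; each of the [K] groups contributes at most
   [1]. *)
apply: (@le_trans _ _ (\sum_(k < K) \sum_(n | c n == k) Pr (V n))); last first.
  by apply: lee_sum => k _; exact: sum_prob_visited_le.
rewrite (exchange_big_dep xpredT)//= big_mkcond/=.
apply: lee_sum => n _; case: ifP => cK; last by apply: sume_ge0.
by rewrite (big_pred1 (Ordinal cK))// => k; rewrite eq_sym.
Qed.

End batch_sync.

Theorem lemma2 (R : realType) (K P : nat) (hK : (1 <= K)%N) (hP : (0 < P)%N)
  (d : measure_display) (Omega : measurableType d) (Pr : probability Omega R)
  (* computation time of worker i on its j-th mini-batch of the iteration *)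
  (X : 'I_P -> nat -> {RV Pr >-> R})
  (X_iid : iid (fun ij : 'I_P * nat => X ij.1 ij.2))
  (X_nlu : forall i j, new_longer_than_used (X i j))
  (* the i.i.d. copies X_1, ..., X_P, possibly on another probability space *)
  (d' : measure_display) (Omega' : measurableType d')
  (Pr' : probability Omega' R)
  (Y : 'I_P -> {RV Pr' >-> R})
  (Y_iid : iid Y)
  (Y_copy : forall i j k, identically_distributed (Y k) (X i j)) :
  'E_Pr[fun w => iteration_runtime (fun i j => X i j w) K]
    <= K%:R%:E *
       'E_Pr'[fun w => \big[Num.min/Y (Ordinal hP) w]_(i < P) Y i w].
Proof.
exact: (expectation_iteration_runtime_le X_iid X_nlu Y_iid Y_copy).
Qed.
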